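(* Let $\mathbf{W}=(W_1,W_2,\ldots,W_k)$ be a random vector in $\mathbb{R}^k$ with nonnegative coordinates, with (finite) mean vector $\boldsymbol{\mu}=(\mu_1,\dots,\mu_k)\succ\mathbf{0}$ and (finite) vector of standard deviations $\boldsymbol{\sigma}=(\sigma_1,\dots,\sigma_k)\succ\mathbf{0}$, i.e. $\mu_i=E(W_i)$ and $\sigma_i^2=\mathrm{var}(W_i)$. Suppose that for each $i=1,2,\ldots,k$ there is a coupling $(\mathbf{W},\mathbf{W}^i)$ of $\mathbf{W}$ with a random vector $\mathbf{W}^i$ having the $\mathbf{W}$ size biased distribution in direction $i$, such that $\|\mathbf{W}-\mathbf{W}^i\|_2\le K$ (almost surely) for some constant $K$ not depending on $i$. Let $\sigma_{(1)}=\min_{i=1,2,\ldots,k}\sigma_i$. Then for any $\mathbf{t}\succeq\mathbf{0}$ in $\mathbb{R}^k$, $$P\left(\frac{\mathbf{W}-\boldsymbol{\mu}}{\boldsymbol{\sigma}}\succeq\mathbf{t}\right)\le\exp\left(-\frac{\|\mathbf{t}\|_2^2}{2(K_1+K_2\|\mathbf{t}\|_2)}\right),$$ where $$K_1=\frac{2K}{\sigma_{(1)}}\left\|\frac{\boldsymbol{\mu}}{\boldsymbol{\sigma}}\right\|_2\quad\text{and}\quad K_2=\frac{K}{2\sigma_{(1)}}.$$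
   Context: For $\mathbf{a},\mathbf{b}\in\mathbb{R}^k$, $\mathbf{a}\succeq\mathbf{b}$ means $a_i\ge b_i$ for all $i$, and $\mathbf{a}\succ\mathbf{b}$ means $a_i>b_i$ for all $i$. Division of vectors is coordinatewise: $\boldsymbol{\theta}/\boldsymbol{\phi}=(\theta_1/\phi_1,\ldots,\theta_k/\phi_k)$. $\|\cdot\|_2$ is the Euclidean norm. If $\mathbf{W}$ has law $dF$ and $\mu_i=E(W_i)>0$, the $\mathbf{W}$ size biased variate in direction $i$, $\mathbf{W}^i$, is a random vector with law $dF^i(x_1,\ldots,x_k)=\frac{x_i}{\mu_i}\,dF(x_1,\ldots,x_k)$; equivalently $E(W_if(\mathbf{W}))=\mu_iE(f(\mathbf{W}^i))$ for all functions $f$ for which these expectations are finite. A coupling means that $\mathbf{W}$ and $\mathbf{W}^i$ are defined on a common probability space. *)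

(* Defs.v *)
From HB Require Import structures.
From mathcomp Require Import all_boot all_order all_algebra.
From mathcomp Require Import all_classical all_reals all_analysis.

Set Implicit Arguments.
Unset Strict Implicit.
Unset Printing Implicit Defensive.

Import Order.TTheory GRing.Theory Num.Theory.
Import numFieldNormedType.Exports.

Local Open Scope classical_set_scope.
Local Open Scope ring_scope.

(* R^k is [k.-tuple R], which carries the product sigma-algebra. *)

Definition vsub (R : realType) (k : nat) (a b : k.-tuple R) : k.-tuple R :=
  [tuple tnth a i - tnth b i | i < k].

Definition vdiv (R : realType) (k : nat) (a b : k.-tuple R) : k.-tuple R :=
  [tuple tnth a i / tnth b i | i < k].

Definition vge (R : realType) (k : nat) (a b : k.-tuple R) : Prop :=
  forall i : 'I_k, tnth b i <= tnth a i.

Definition vgt (R : realType) (k : nat) (a b : k.-tuple R) : Prop :=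
  forall i : 'I_k, tnth b i < tnth a i.

Definition vzero (R : realType) (k : nat) : k.-tuple R := [tuple 0 | i < k].

Definition norm2 (R : realType) (k : nat) (a : k.-tuple R) : R :=
  Num.sqrt (\sum_(i < k) tnth a i ^+ 2).

(* The base value of the iterated minimum is itself one of the coordinates. *)
Definition vmin (R : realType) (n : nat) (a : n.+1.-tuple R) : R :=
  \big[Num.min/tnth a ord0]_(i < n.+1) tnth a i.

Definition has_law (R : realType) (k : nat) (d : measure_display)
    (T : measurableType d) (Q : probability T R) (V : {RV Q >-> k.-tuple R})
    (F : set (k.-tuple R) -> \bar R) : Prop :=
  forall A : set (k.-tuple R), measurable A -> distribution Q V A = F A.

(* dF^i(x) = (x_i / mu_i) dF(x), where mu_i is the i-th mean of F; meaningful
   when F has nonnegative coordinates and 0 < mu_i < +oo. *)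
Definition size_biased_law (R : realType) (k : nat)
    (F : probability (k.-tuple R) R) (i : 'I_k) (A : set (k.-tuple R)) :
    \bar R :=
  (\int[F]_(x in A) (tnth x i / fine 'E_F[fun y => tnth y i])%:E)%E.

(* The common probability space may depend on i: only the law F of the first
   vector is fixed. *)
Definition bounded_size_biased_coupling (R : realType) (k : nat)
    (F : probability (k.-tuple R) R) (i : 'I_k) (K : R) : Prop :=
  exists (d : measure_display) (T : measurableType d) (Q : probability T R)
         (V Vi : {RV Q >-> k.-tuple R}),
    [/\ has_law V F,
        has_law Vi (size_biased_law F i) &
        \forall w \ae Q, norm2 (vsub (V w) (Vi w)) <= K].

(* Main.v *)
Require Import Defs.
From HB Require Import structures.
From mathcomp Require Import all_boot all_order all_algebra.
From mathcomp Require Import all_classical all_reals all_analysis.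
From mathcomp Require Import measurable_realfun ring lra.

(** Put a_i = t_i / sigma_i and Y = \sum_i a_i W_i. The event forces
    Y >= nu + |t|^2 with nu = E Y = \sum_i a_i mu_i. Size biasing and
    Cauchy-Schwarz give, with C = |a| K,
    E (Y e^(l Y)) = \sum_i a_i mu_i E e^(l Y(W^i)) <= nu e^(l C) E e^(l Y),
    that is m' <= nu e^(l C) m for the moment generating function m of Y. Since
    e^x <= 1 + 2 x on [0, 1], m(l) <= exp(nu l + nu C l^2) when l C <= 1, and
    Markov's inequality with a suitable l concludes. The argument is run with Y
    truncated, so that m is finite, and with difference quotients of m in place
    of its derivative. *)

Set Implicit Arguments.
Unset Strict Implicit.
Unset Printing Implicit Defensive.

Import Order.TTheory GRing.Theory Num.Theory.
Import numFieldNormedType.Exports.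

Local Open Scope classical_set_scope.
Local Open Scope ring_scope.

(** * Exponential inequalities and a discrete Gronwall bound *)

Lemma expR1_le3 (R : realType) : expR (1 : R) <= 3.
Proof.
(* Inverting [5 / 6 <= expR (- 6^-1)] gives this; the sixth power is [(6 / 5) ^+ 6 = 2.985984],
   while [(5 / 4) ^+ 5] would exceed 3. *)
have h : expR (6^-1 : R) <= 6 / 5.
  have := expR_ge1Dx (- 6^-1 : R); rewrite expRN => h.
  have e0 := expR_gt0 (6^-1 : R).
  rewrite -[leLHS]invrK -[leRHS]invrK lef_pV2 ?posrE ?invr_gt0 //; lra.
have -> : (1 : R) = 6%:R * 6^-1 by lra.
rewrite expRM_natl (@le_trans _ _ ((6 / 5) ^+ 6)) //.
  by rewrite lerXn2r // nnegrE ?expR_ge0 //; lra.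
lra.
Qed.

(** By convexity the exponential lies below its chord on [0, 1], whose slope [expR 1 - 1] is at most
    2. *)
Lemma expR_le1D2x (R : realType) (x : R) : 0 <= x <= 1 -> expR x <= 1 + 2 * x.
Proof.
move=> /andP[x0 x1].
have := @convex_expR R (Itv01 x0 x1) 1 0.
rewrite !convRE /= expR0 mulr0 addr0 !mulr1 => /le_trans; apply.
have := expR1_le3 R; rewrite /unstable.onem; nra.
Qed.

(** The left side is [1 + y / (1 - y) <= expR (y / (1 - y))], and [y / (1 - y) <= y + 2 * y ^+ 2]
    amounts to [0 <= y ^+ 2 * (1 - 2 * y)]. *)
Lemma inv1B_le_expR (R : realType) (y : R) :
  0 <= y <= 2^-1 -> (1 - y)^-1 <= expR (y + 2 * y ^+ 2).
Proof.
move=> /andP[y0 y1].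
have y'0 : 0 < 1 - y by lra.
have -> : (1 - y)^-1 = 1 + y / (1 - y) by field; lra.
apply: le_trans (expR_ge1Dx _) _; rewrite ler_expR ler_pdivrMr //; nra.
Qed.

(* Discrete Gronwall inequality: the hypothesis is iterated along a grid of mesh
   [lam / N], with a total error [O(1 / N)] in the exponent. *)
Lemma expR_gronwall (R : realType) (m : R -> R) (nu C lam : R) :
  0 <= nu -> 0 <= C -> 0 <= lam -> lam * C <= 1 ->
  (forall b, 0 <= b -> 0 < m b) -> m 0 <= 1 ->
  (forall a b, 0 <= a -> a <= b -> b <= lam ->
     m b <= m a + (b - a) * (nu * expR (b * C) * m b)) ->
  m lam <= expR (nu * lam + nu * C * lam ^+ 2).
Proof.
move=> nu0 C0 lam0 lamC m_gt0 m0 step.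
pose phi a := nu * a + nu * C * a ^+ 2.
(* A grid step of length [h] costs at most [h ^+ 2 * D] in the exponent: [18 * nu ^+ 2] comes from
   [2 * y ^+ 2] with [y <= 3 * (h * nu)], and [nu * C] from the increment of [phi]. *)
pose D := 18 * nu ^+ 2 + nu * C.
have D0 : 0 <= D by rewrite /D; nra.
(* The lower bound on [N] ensures [y <= 2^-1] below. *)
have grid N : 6 * (nu * lam) <= N%:R -> (0 < N)%N ->
    m lam <= expR (phi lam + lam ^+ 2 * D / N%:R).
  move=> Nbig N0; pose h := lam / N%:R.
  have N0' : 0 < N%:R :> R by rewrite ltr0n.
  have hN : N%:R * h = lam by rewrite /h; field; lra.
  have h0 : 0 <= h by rewrite /h divr_ge0 // ltW.
  have nuh : 6 * (nu * h) <= 1.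
    by rewrite /h !mulrA ler_pdivrMr // mul1r -mulrA.
  have P k : (k <= N)%N ->
      m (k%:R * h) <= expR (phi (k%:R * h) + k%:R * (h ^+ 2 * D)).
    elim: k => [|k IH] kN.
      by rewrite !mul0r /phi expr0n /= !mulr0 !addr0 expR0.
    have {}IH := IH (ltnW kN).
    set a := k%:R * h; set b := k.+1%:R * h.
    have ba : b = a + h by rewrite /a /b -natr1 mulrDl mul1r.
    have a0 : 0 <= a by rewrite /a mulr_ge0.
    have b1 : b <= lam by rewrite -hN /b ler_wpM2r // ler_nat.
    have ab : a <= b by lra.
    have b0 : 0 <= b by lra.
    have bC : b * C <= 1 by apply: le_trans lamC; rewrite ler_wpM2r.
    have bC0 : 0 <= b * C by rewrite mulr_ge0.
    have := step a b a0 ab b1.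
    have eb : expR (b * C) <= 1 + 2 * (b * C) by rewrite expR_le1D2x // bC0.
    (* As in an implicit Euler scheme, [m b] is bounded through itself; [y] dominates its
       coefficient and moves to the left as the factor [1 - y]. *)
    pose y := h * nu * (1 + 2 * (b * C)).
    have hnu0 : 0 <= h * nu by rewrite mulr_ge0.
    have y0 : 0 <= y by rewrite /y mulr_ge0 //; lra.
    have y3 : y <= 3 * (h * nu) by rewrite /y; nra.
    have y1 : y <= 2^-1 by lra.
    have yb := @inv1B_le_expR R y; rewrite y0 y1 in yb; have {}yb := yb isT.
    have mb := m_gt0 b b0.
    have -> : b - a = h by lra.
    have : h * (nu * expR (b * C) * m b) <= y * m b.
      by rewrite !mulrA ler_pM2r // /y ler_wpM2l.
    move=> H1 H2.
    have H3 : m b <= m a * (1 - y)^-1 by rewrite ler_pdivlMr; lra.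
    apply: le_trans H3 _.
    have ma := m_gt0 a a0.
    have : m a * (1 - y)^-1 <= expR (phi a + k%:R * (h ^+ 2 * D)) * expR (y + 2 * y ^+ 2).
      by apply: ler_pM; rewrite ?invr_ge0 //; lra.
    move=> /le_trans; apply; rewrite -expRD ler_expR.
    have -> : phi b = phi a + y - nu * C * h ^+ 2.
      by rewrite /phi /y ba; ring.
    have : y ^+ 2 <= 9 * (h * nu) ^+ 2 by nra.
    rewrite -natr1 mulrDl mul1r /D exprMn; lra.
  have := P N (leqnn N); rewrite hN; move=> /le_trans; apply.
  rewrite ler_expR lerD2l le_eqVlt; apply/orP; left; apply/eqP.
  by rewrite /h; field; lra.
rewrite -ler_ln ?posrE ?expR_gt0 ?m_gt0 // expRK -/(phi lam).
apply/ler_addgt0Pl => e e0.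
(* Any [N] beyond [X] meets the grid condition and brings the error in the exponent below [e]. *)
pose X := 6 * (nu * lam) + lam ^+ 2 * D / e.
have X0 : 0 <= X by rewrite /X addr_ge0 ?mulr_ge0 ?sqr_ge0 ?invr_ge0 // ltW.
have := archi_boundP X0; set N := Num.Def.archi_bound X => XN.
have lD : 0 <= lam ^+ 2 * D by rewrite mulr_ge0 ?sqr_ge0.
have lDe : 0 <= lam ^+ 2 * D / e by rewrite mulr_ge0 // invr_ge0 ltW.
have nl : 0 <= nu * lam by rewrite mulr_ge0.
have N0 : 0 < N%:R :> R by lra.
have : m lam <= expR (phi lam + lam ^+ 2 * D / N%:R).
  apply: grid; last by rewrite -(ltr0n R).
  by rewrite /X in XN; lra.
rewrite -ler_ln ?posrE ?expR_gt0 ?m_gt0 // expRK => /le_trans; apply.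
rewrite addrC lerD2r ler_pdivrMr // -ler_pdivrMl // mulrC.
by rewrite /X in XN; lra.
Qed.

(** * Densities, Cauchy-Schwarz and measurability *)

(** The density makes [nu] absolutely continuous; its Radon-Nikodym derivative has the same
    integrals as [phi], so the two agree almost everywhere and the change of variables carries
    over. *)
Lemma integral_density d (T : measurableType d) (R : realType)
    (mu nu : probability T R) (phi g : T -> \bar R) :
  measurable_fun setT phi -> (forall x, 0 <= phi x)%E ->
  (forall A, measurable A -> nu A = \int[mu]_(x in A) phi x)%E ->
  measurable_fun setT g -> (forall x, 0 <= g x)%E ->
  (\int[nu]_x g x = \int[mu]_x (g x * phi x))%E.
Proof.
move=> mphi phi0 nuE mg g0.
have numu : nu `<< mu.
  apply/null_content_dominatesP => A mA muA0; rewrite nuE //.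
  by rewrite null_set_integral //; exact: measurable_funTS.
rewrite -(Radon_Nikodym_SigmaFinite.change_of_variables numu) //.
have fint := Radon_Nikodym_SigmaFinite.f_integrable numu.
apply: ge0_ae_eq_integral => //.
- by apply: emeasurable_funM => //; exact: measurable_int fint.
- exact: emeasurable_funM.
- by move=> x _; rewrite mule_ge0 // Radon_Nikodym_SigmaFinite.f_ge0.
- by move=> x _; rewrite mule_ge0.
apply: ae_eqe_mul2l; apply: integral_ae_eq => // A _ mA.
by rewrite -nuE // -Radon_Nikodym_SigmaFinite.f_integral.
Qed.

Lemma cauchy_schwarz (R : rcfType) (k : nat) (a b : 'I_k -> R) :
  \sum_(i < k) a i * b i <=
  Num.sqrt (\sum_(i < k) a i ^+ 2) * Num.sqrt (\sum_(i < k) b i ^+ 2).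
Proof.
set A := \sum_(i < k) a i ^+ 2; set B := \sum_(i < k) b i ^+ 2.
set S := \sum_(i < k) _.
have A0 : 0 <= A by rewrite sumr_ge0 // => i _; rewrite sqr_ge0.
have B0 : 0 <= B by rewrite sumr_ge0 // => i _; rewrite sqr_ge0.
have q x y : 0 <= x ^+ 2 * A - 2 * x * y * S + y ^+ 2 * B.
  rewrite /A /B /S !mulr_sumr -sumrB -big_split /= sumr_ge0 // => i _.
  have -> : x ^+ 2 * a i ^+ 2 - 2 * x * y * (a i * b i) + y ^+ 2 * b i ^+ 2 =
    (x * a i - y * b i) ^+ 2 by ring.
  exact: sqr_ge0.
rewrite -sqrtrM // (le_trans (ler_norm _)) // -sqrtr_sqr ler_wsqrtr //.
have [B00|B00] := eqVneq B 0.
  (* Here [q] reads [0 <= - (A + 2) * S ^+ 2], which forces [S = 0]. *)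
  by have := q S (A + 1); rewrite B00; nra.
have := q B S; have Bgt : 0 < B by rewrite lt0r B00.
have -> : B ^+ 2 * A - 2 * B * S * S + S ^+ 2 * B = B * (A * B - S ^+ 2).
  by ring.
by rewrite pmulr_rge0 // subr_ge0.
Qed.

Lemma measurable_superlevel d (T : measurableType d) (R : realType)
    (f : T -> R) (c : R) :
  measurable_fun setT f -> measurable [set x | c <= f x].
Proof.
move=> mf; rewrite (_ : [set x | _] = f @^-1` `[c, +oo[).
  by rewrite -[X in measurable X]setTI; exact: mf.
by apply/seteqP; split => x; rewrite /= in_itv /= andbT.
Qed.

(** Coordinates are nonnegative only almost surely; their positive parts are so everywhere, which
    suits integrals of nonnegative functions. *)
Lemma measurable_tnth_pos (R : realType) (k : nat) (i : 'I_k) :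
  measurable_fun [set: k.-tuple R] (fun x => Num.max (tnth x i) 0).
Proof. by apply: measurable_maxr => //; exact: measurable_tnth. Qed.

(** * Size biasing and the exponential tail bound *)

(** The left side is [mu] times the mean of [g] at the size biased vector, and the coupling bounds
    that value by [c] times [g] at the original vector. The coupling space varies with [i], so both
    means are moved to [F]. *)
Lemma size_bias_integral_le (R : realType) (k : nat)
    (F : probability (k.-tuple R) R) (i : 'I_k) (K mu c : R)
    (g : k.-tuple R -> R) :
  (\forall x \ae F, 0 <= tnth x i) -> 0 < mu ->
  'E_F[fun x => tnth x i]%E = mu%:E ->
  bounded_size_biased_coupling F i K ->
  0 <= c ->
  measurable_fun setT g -> (forall x, 0 <= g x) ->
  (forall x y, norm2 (vsub x y) <= K -> g y <= c * g x) ->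
  (\int[F]_x (g x * Num.max (tnth x i) 0)%:E
   <= (mu * c)%:E * \int[F]_x (g x)%:E)%E.
Proof.
move=> x0 mu0 Fmu [d [T [Q [V [Vi [hV hVi VK]]]]]] c0 mg g0 gc.
have mgE : measurable_fun setT (EFin \o g) by exact/measurable_EFinP.
have gE0 x : (0 <= (EFin \o g) x)%E by rewrite /= lee_fin.
pose phi x : \bar R := (mu^-1 * Num.max (tnth x i) 0)%:E.
have mphi : measurable_fun setT phi.
  apply/measurable_EFinP; apply: measurable_funM => //.
  exact: measurable_tnth_pos.
have p0 (x : k.-tuple R) : 0 <= Num.max (tnth x i) 0 by rewrite le_max lexx orbT.
have phi0 x : (0 <= phi x)%E by rewrite lee_fin mulr_ge0 // invr_ge0 ltW.
have ViE A : measurable A -> (distribution Q Vi A = \int[F]_(x in A) phi x)%E.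
  move=> mA; rewrite hVi // /size_biased_law Fmu /=.
  apply: ae_eq_integral => //.
  - apply: measurable_funTS; apply/measurable_EFinP.
    by apply: measurable_funM => //; exact: measurable_tnth.
  - exact: measurable_funTS.
  apply: filterS x0 => x x0 _ /=.
  by rewrite /phi max_l // mulrC.
have gVi : (\int[Q]_w (g (Vi w))%:E = \int[F]_x ((g x)%:E * phi x))%E.
  rewrite -(@integral_density _ _ _ F (distribution Q Vi) phi (EFin \o g)) //.
  by rewrite (ge0_integral_distribution _ mgE gE0).
have gV : (\int[Q]_w (g (V w))%:E = \int[F]_x (g x)%:E)%E.
  have := ge0_integral_distribution V mgE gE0; rewrite /comp => <-.
  by apply: eq_measure_integral => A mA _; exact: hV.
have -> : (\int[F]_x (g x * Num.max (tnth x i) 0)%:E =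
    mu%:E * \int[Q]_w (g (Vi w))%:E)%E.
  rewrite gVi -ge0_integralZl //.
  - apply: eq_integral => x _; rewrite /phi -!EFinM; congr EFin.
    by field; rewrite gt_eqF.
  - by apply: emeasurable_funM.
  - by move=> x _; rewrite mule_ge0 // lee_fin.
  - by rewrite lee_fin ltW.
rewrite EFinM -muleA lee_pmul2l // -gV.
have mgX (X : {RV Q >-> k.-tuple R}) : measurable_fun setT (g \o X).
  by apply: measurableT_comp.
rewrite -ge0_integralZl //; [|by apply/measurable_EFinP; exact: mgX
  |by move=> *; rewrite lee_fin].
apply: ae_ge0_le_integral => //.
- by move=> w _; rewrite lee_fin.
- by apply/measurable_EFinP; exact: mgX.
- by move=> w _; rewrite -EFinM lee_fin mulr_ge0.
- apply: emeasurable_funM => //; apply/measurable_EFinP; exact: mgX.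
by apply: filterS VK => w VwK _; rewrite -EFinM lee_fin; exact: gc.
Qed.

Lemma ae_distribution d d' (T : measurableType d) (T' : measurableType d')
    (R : realType) (P : probability T R) (X : {RV P >-> T'}) (A : set T') :
  measurable A -> (\forall w \ae P, A (X w)) ->
  \forall x \ae distribution P X, A x.
Proof.
move=> mA [N [mN N0 sub]]; exists (~` A); split => //; first exact: measurableC.
rewrite /distribution /pushforward /=; apply/eqP.
rewrite -measure_le0 -N0 le_measure ?inE //.
rewrite -[X @^-1` _]setTI.
by apply: measurable_funPT => //; exact: measurableC.
Qed.

(** The positive part is 1-Lipschitz; Cauchy-Schwarz does the rest. *)
Lemma weighted_pos_lipschitz (R : realType) (k : nat) (a x y : k.-tuple R) :
  vge a (vzero R k) ->
  \sum_(i < k) tnth a i * Num.max (tnth y i) 0 <=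
  \sum_(i < k) tnth a i * Num.max (tnth x i) 0 + norm2 a * norm2 (vsub x y).
Proof.
move=> a0; rewrite -lerBlDl -sumrB.
have -> : norm2 (vsub x y) =
    Num.sqrt (\sum_(i < k) `|tnth x i - tnth y i| ^+ 2).
  congr Num.sqrt; apply: eq_bigr => i _.
  by rewrite tnth_mktuple real_normK ?num_real.
apply: le_trans (cauchy_schwarz _ _); apply: ler_sum => i _.
have := a0 i; rewrite tnth_mktuple => ai; rewrite -mulrBr ler_wpM2l //.
move: (tnth x i) (tnth y i) => u v; rewrite distrC.
have := ler_norm (v - u); have := normr_ge0 (v - u).
by case: (lerP v 0); case: (lerP u 0); lra.
Qed.

(** Markov's inequality for an exponential moment, which size biasing and the Gronwall bound
    control. *)
Lemma size_bias_tail (R : realType) (k : nat) (F : probability (k.-tuple R) R)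
    (a mu : k.-tuple R) (K M lam : R) :
  (forall i, \forall x \ae F, 0 <= tnth x i) ->
  vge a (vzero R k) -> vgt mu (vzero R k) -> 0 <= K -> 0 <= M ->
  (forall i, 'E_F[fun x => tnth x i]%E = (tnth mu i)%:E) ->
  (forall i, bounded_size_biased_coupling F i K) ->
  0 <= lam -> lam * (norm2 a * K) <= 1 ->
  (F [set x | (M <= \sum_(i < k) tnth a i * Num.max (tnth x i) 0)%R]
   <= (expR ((\sum_(i < k) tnth a i * tnth mu i) *
        (lam + norm2 a * K * lam ^+ 2) - lam * M))%:E)%E.
Proof.
move=> x0 a0 mu0 K0 M0 Fmu coup lam0 lamC.
set nu := \sum_(i < k) _ * tnth mu i.
have {}a0 i : 0 <= tnth a i by have := a0 i; rewrite tnth_mktuple.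
have {}mu0 i : 0 < tnth mu i by have := mu0 i; rewrite tnth_mktuple.
set C := norm2 a * K in lamC *.
have C0 : 0 <= C by rewrite mulr_ge0 // sqrtr_ge0.
have p0 i (x : k.-tuple R) : 0 <= Num.max (tnth x i) 0 by rewrite le_max lexx orbT.
pose Y (x : k.-tuple R) := \sum_(i < k) tnth a i * Num.max (tnth x i) 0.
have Y0 x : 0 <= Y x by rewrite sumr_ge0 // => i _; rewrite mulr_ge0.
have mY : measurable_fun setT Y.
  apply: measurable_sum => i; apply: measurable_funM => //.
  exact: measurable_tnth_pos.
(* Truncating at the level [M] of the tail leaves the event unchanged and makes
   the moment generating function finite. *)
pose Z x := Num.min (Y x) M.
have Z0 x : 0 <= Z x by rewrite le_min Y0.
have ZM x : Z x <= M by rewrite ge_min lexx orbT.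
have ZY x : Z x <= Y x by rewrite ge_min lexx.
have mZ : measurable_fun setT Z by apply: measurable_minr.
pose g b x := expR (b * Z x).
have g0 b x : 0 <= g b x by exact: expR_ge0.
have mg b : measurable_fun setT (g b).
  by apply: measurableT_comp => //; exact: measurable_funM.
have mgE b : measurable_fun setT (fun x => (g b x)%:E).
  exact/measurable_EFinP.
have g_shift b x y : 0 <= b -> norm2 (vsub x y) <= K ->
    g b y <= expR (b * C) * g b x.
  move=> b0 xyK; rewrite /g -expRD ler_expR -mulrDr ler_wpM2l //.
  have YC : Y y <= C + Y x.
    rewrite addrC (le_trans (@weighted_pos_lipschitz _ _ a x y _)) //.
      by move=> i; rewrite tnth_mktuple.
    by rewrite lerD2l ler_wpM2l // sqrtr_ge0.
  (* Truncation keeps the shift bound, since [M <= C + M]. *)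
  rewrite /Z -lerBlDl le_min !lerBlDl !ge_min YC /=.
  by rewrite orbC -{1}[M]add0r lerD2r C0.
have Fcst (r : R) : (\int[F]_x (cst r%:E x) = r%:E)%E.
  by rewrite integral_cst // [X in (_ * X)%E](@probability_setT _ _ _ F) mule1.
have J_ge1 b : 0 <= b -> (1 <= \int[F]_x (g b x)%:E)%E.
  move=> b0; rewrite -(Fcst 1); apply: ge0_le_integral => // x _.
  by rewrite lee_fin /g -expR0 ler_expR mulr_ge0.
have J_le b : 0 <= b -> (\int[F]_x (g b x)%:E <= (expR (b * M))%:E)%E.
  move=> b0; rewrite -(Fcst (expR (b * M))); apply: ge0_le_integral => // x _.
    by rewrite lee_fin expR_ge0.
  by rewrite lee_fin /g ler_expR ler_wpM2l.
pose m b := fine (\int[F]_x (g b x)%:E)%E.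
have mE b : 0 <= b -> (\int[F]_x (g b x)%:E = (m b)%:E)%E.
  move=> b0; rewrite /m fineK // ge0_fin_numE ?(le_lt_trans (J_le b b0)) ?ltry //.
  by apply: le_trans (J_ge1 b b0).
have mlam : m lam <= expR (nu * lam + nu * C * lam ^+ 2).
  apply: expR_gronwall => //.
  - by rewrite sumr_ge0 // => i _; rewrite mulr_ge0 // ltW.
  - move=> b b0; apply: (@lt_le_trans _ _ 1) => //.
    by have := J_ge1 b b0; rewrite mE.
  - by rewrite -lee_fin -mE // (le_trans (J_le 0 _)) // mul0r expR0.
  move=> c b c0 cb _; have b0 := le_trans c0 cb.
  have bc0 : 0 <= b - c by rewrite subr_ge0.
  have mi i : measurable_fun setT
      (fun x => (tnth a i * (g b x * Num.max (tnth x i) 0))%:E).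
    apply/measurable_EFinP; apply: measurable_funM => //.
    by apply: measurable_funM => //; exact: measurable_tnth_pos.
  have i0 i x : (0 <= (tnth a i * (g b x * Num.max (tnth x i) 0))%:E)%E.
    by rewrite lee_fin !mulr_ge0.
  have S0 x : (0 <= \sum_(i < k) (tnth a i * (g b x * Num.max (tnth x i) 0))%:E)%E.
    by rewrite sume_ge0.
  have mS : measurable_fun setT (fun x =>
      \sum_(i < k) (tnth a i * (g b x * Num.max (tnth x i) 0))%:E)%E.
    by apply: emeasurable_sum => i; exact: mi.
  rewrite -lee_fin EFinD EFinM -!mE //.
  apply: (@le_trans _ _ (\int[F]_x ((g c x)%:E + (b - c)%:E *
      \sum_(i < k) (tnth a i * (g b x * Num.max (tnth x i) 0))%:E))%E).
    apply: ge0_le_integral => //.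
    - by move=> x _; rewrite lee_fin.
    - by apply: emeasurable_funD => //; exact: emeasurable_funM.
    move=> x _; rewrite sumEFin -EFinM -EFinD lee_fin.
    have -> : \sum_(i < k) tnth a i * (g b x * Num.max (tnth x i) 0) = g b x * Y x.
      by rewrite mulr_sumr; apply: eq_bigr => i _; ring.
    (* tangent inequality: g b - g c <= (b - c) * Z * g b *)
    have e1 := expR_ge1Dx ((c - b) * Z x).
    have -> : g c x = g b x * expR ((c - b) * Z x).
      by rewrite /g -expRD; congr expR; ring.
    have h1 := ler_wpM2l (g0 b x) e1.
    (* Passing from [Z] back to [Y] restores linearity in the positive parts, so each coordinate can
       be size biased separately. *)
    have h2 := ler_wpM2l (mulr_ge0 bc0 (g0 b x)) (ZY x).
    lra.
  rewrite ge0_integralD //; first last.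
  - by apply: emeasurable_funM.
  - by move=> x _; rewrite mule_ge0.
  - by move=> x _; rewrite lee_fin.
  rewrite leeD2l // ge0_integralZl // lee_wpmul2l //.
  rewrite ge0_integral_sum //.
  rewrite (_ : (_ * m b)%:E = (\sum_(i < k) (tnth a i)%:E *
     ((tnth mu i * expR (b * C))%:E * \int[F]_x (g b x)%:E))%E); last first.
    rewrite mE // sumEFin; congr EFin; rewrite /nu !mulr_suml.
    by apply: eq_bigr => i _; ring.
  apply: lee_sum => i _.
  under eq_integral do rewrite EFinM.
  rewrite ge0_integralZl //; first last.
  - by rewrite lee_fin.
  - by move=> x _; rewrite lee_fin mulr_ge0.
  - apply/measurable_EFinP; apply: measurable_funM => //.
    exact: measurable_tnth_pos.
  rewrite lee_wpmul2l ?lee_fin //.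
  apply: (@size_bias_integral_le _ _ _ _ K) => //.
  by move=> x y; exact: g_shift.
set A := [set x | _].
have mA : measurable A by exact: measurable_superlevel.
rewrite -(setIT A) -integral_indic //.
(* Markov's inequality: on [A] the truncated sum equals [M], so the exponential factor is exactly 1
   there. *)
apply: (@le_trans _ _ ((expR (- (lam * M)))%:E * \int[F]_x (g lam x)%:E)%E).
  rewrite -ge0_integralZl //.
  - apply: ge0_le_integral => //.
    + by apply/measurable_EFinP; exact: measurable_indic.
    + by apply: emeasurable_funM.
    move=> x _; rewrite -EFinM lee_fin indicE.
    have [xA|xA] := boolP (x \in A); last by rewrite mulr_ge0 // expR_ge0.
    rewrite /g /Z min_r; last by move: xA; rewrite inE.
    by rewrite -expRD addNr expR0.
  by move=> x _; rewrite lee_fin.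
rewrite mE // -EFinM lee_fin addrC expRD ler_wpM2l ?expR_ge0 //.
by rewrite mulrDr mulrA.
Qed.

(** * The smallest deviation and transfer to the law of the vector *)

Lemma vmin_le (R : realType) (n : nat) (a : n.+1.-tuple R) (i : 'I_n.+1) :
  vmin a <= tnth a i.
Proof. exact: bigmin_le_cond. Qed.

Lemma vmin_gt0 (R : realType) (n : nat) (a : n.+1.-tuple R) :
  vgt a (vzero R n.+1) -> 0 < vmin a.
Proof.
move=> a0; have {}a0 i : 0 < tnth a i by have := a0 i; rewrite tnth_mktuple.
by apply/bigmin_gtP; split.
Qed.

Lemma ae_distribution_tnth_ge0 d (T : measurableType d) (R : realType) (k : nat)
    (P : probability T R) (W : {RV P >-> k.-tuple R}) (i : 'I_k) :
  (\forall w \ae P, 0 <= tnth (W w) i) ->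
  \forall y \ae distribution P W, 0 <= tnth y i.
Proof.
by apply: ae_distribution; exact: measurable_superlevel (measurable_tnth i).
Qed.

(** Both means equal those of the positive part, to which the change of variables for nonnegative
    functions applies. *)
Lemma expectation_distribution_tnth d (T : measurableType d) (R : realType)
    (k : nat) (P : probability T R) (W : {RV P >-> k.-tuple R}) (i : 'I_k) :
  (\forall w \ae P, 0 <= tnth (W w) i) ->
  ('E_(distribution P W)[fun y => tnth y i] = 'E_P[fun w => tnth (W w) i])%E.
Proof.
move=> W0; rewrite unlock.
have mp := @measurable_tnth_pos R k i.
transitivity (\int[distribution P W]_y (Num.max (tnth y i) 0)%:E)%E.
  apply: ae_eq_integral => //.
  - by apply/measurable_EFinP; exact: measurable_tnth.
  - exact/measurable_EFinP.
  apply: filterS (ae_distribution_tnth_ge0 W0) => y y0 _.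
  by rewrite max_l.
rewrite (ge0_integral_distribution _
    (f := fun y : k.-tuple R => (Num.max (tnth y i) 0)%:E)).
- apply: ae_eq_integral => //.
  + apply/measurable_EFinP.
    exact: (measurableT_comp mp (measurable_funPT W)).
  + apply/measurable_EFinP.
    exact: (measurableT_comp (measurable_tnth i) (measurable_funPT W)).
  by apply: filterS W0 => w w0 _ /=; rewrite max_l.
- exact/measurable_EFinP.
- by move=> y; rewrite lee_fin le_max lexx orbT.
Qed.

(** * Choice of the weights and of the exponential parameter *)

Theorem theorem5p1 (R : realType) (n : nat)
    (d : measure_display) (T : measurableType d) (P : probability T R)
    (W : {RV P >-> n.+1.-tuple R}) (mu sigma : n.+1.-tuple R) (K : R)
    (W_ge0 : \forall w \ae P, vge (W w) (vzero R n.+1))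
    (mu_gt0 : vgt mu (vzero R n.+1))
    (sigma_gt0 : vgt sigma (vzero R n.+1))
    (W_mean : forall i : 'I_n.+1,
       'E_P[fun w => tnth (W w) i]%E = (tnth mu i)%:E)
    (W_var : forall i : 'I_n.+1,
       'V_P[fun w => tnth (W w) i]%E = (tnth sigma i ^+ 2)%:E)
    (W_coupling : forall i : 'I_n.+1,
       bounded_size_biased_coupling (distribution P W) i K)
    (t : n.+1.-tuple R) (t_ge0 : vge t (vzero R n.+1)) :
  let K1 := 2 * K / vmin sigma * norm2 (vdiv mu sigma) in
  let K2 := K / (2 * vmin sigma) in
  (P [set w | vge (vdiv (vsub (W w) mu) sigma) t]
   <= (expR (- (norm2 t ^+ 2 / (2 * (K1 + K2 * norm2 t)))))%:E)%E.
Proof.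
have t0 i : 0 <= tnth t i by have := t_ge0 i; rewrite tnth_mktuple.
have m0 i : 0 < tnth mu i by have := mu_gt0 i; rewrite tnth_mktuple.
have s0 i : 0 < tnth sigma i by have := sigma_gt0 i; rewrite tnth_mktuple.
cbv zeta.
set s := vmin sigma; set N := norm2 (vdiv mu sigma); set tau := norm2 t.
have smin0 : 0 < s by exact: vmin_gt0.
have N0 : 0 <= N by exact: sqrtr_ge0.
have tau0 : 0 <= tau by exact: sqrtr_ge0.
have tau2 : tau ^+ 2 = \sum_(i < n.+1) tnth t i ^+ 2.
  by rewrite /tau sqr_sqrtr // sumr_ge0 // => i _; exact: sqr_ge0.
have mW i : measurable_fun setT (fun w => tnth (W w) i).
  exact: (measurableT_comp (measurable_tnth i) (measurable_funPT W)).
have mE : measurable [set w | vge (vdiv (vsub (W w) mu) sigma) t].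
  rewrite (_ : [set w | _] = \bigcap_(i in [set: 'I_n.+1])
      [set w | tnth t i <= (tnth (W w) i - tnth mu i) / tnth sigma i]).
    apply: fin_bigcap_measurable => [|i _]; first exact: finite_finset.
    apply: measurable_superlevel; apply: measurable_funM => //.
    exact: measurable_funB.
  apply/seteqP; split => w /= Ww i.
    by move=> _; have := Ww i; rewrite !tnth_mktuple.
  by rewrite !tnth_mktuple; exact: Ww.
(* A vanishing denominator (K = 0) falls under this case, division by zero
   being zero. *)
have [triv|] := leP (tau ^+ 2 / (2 * (2 * K / s * N + K / (2 * s) * tau))) 0.
  apply: (@le_trans _ _ 1%E); last by rewrite lee_fin -[leLHS]expR0 ler_expR oppr_ge0.
  exact: probability_le1 mE.
move=> nontriv.
have {nontriv}[K0 tau_gt0] : 0 < K /\ 0 < tau.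
  have tau_gt0 : 0 < tau.
    rewrite lt0r tau0 andbT; apply: contraTneq nontriv => ->.
    by rewrite expr0n /= mul0r ltxx.
  split=> //; rewrite ltNge; apply: contraTN nontriv => K0.
  rewrite -leNgt mulr_ge0_le0 ?sqr_ge0 // invr_le0 pmulr_rle0 //.
  have s2 : 0 < (2 * s)^-1 by rewrite invr_gt0; lra.
  have s1 : 0 < s^-1 by rewrite invr_gt0.
  have NS : 0 <= N * s^-1 by rewrite mulr_ge0 // ltW.
  have TS : 0 <= tau * (2 * s)^-1 by rewrite mulr_ge0 // ltW.
  have := mulr_ge0_le0 NS K0; have := mulr_ge0_le0 TS K0; lra.
pose a := vdiv t sigma.
have aE i : tnth a i = tnth t i / tnth sigma i by rewrite tnth_mktuple.
pose nu := \sum_(i < n.+1) tnth a i * tnth mu i.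
have a0 : vge a (vzero R n.+1).
  by move=> i; rewrite aE tnth_mktuple divr_ge0 // ltW.
have nu0 : 0 <= nu.
  rewrite sumr_ge0 // => i _.
  by rewrite mulr_ge0 ?(ltW (m0 _)) // aE divr_ge0 // ltW.
have nu_le : nu <= tau * N.
  have := cauchy_schwarz (tnth t) (tnth (vdiv mu sigma)); congr (_ <= _).
  by apply: eq_bigr => i _; rewrite aE tnth_mktuple; field; rewrite gt_eqF.
have a_le : norm2 a <= tau / s.
  have -> : tau / s = Num.sqrt (tau ^+ 2 / s ^+ 2).
    by rewrite -expr_div_n sqrtr_sqr ger0_norm // divr_ge0 // ltW.
  apply: ler_wsqrtr; rewrite tau2 mulr_suml; apply: ler_sum => i _.
  rewrite aE expr_div_n ler_wpM2l ?sqr_ge0 // lef_pV2 ?posrE ?exprn_gt0 //.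
  by rewrite ler_sqr ?nnegrE ?(ltW smin0) ?(ltW (s0 i)) // vmin_le.
(* This [C] dominates [norm2 a * K] and involves only the quantities of the claim. *)
pose C := tau * K / s.
have C_gt0 : 0 < C by rewrite divr_gt0 // mulr_gt0.
have aK_le : norm2 a * K <= C by rewrite /C mulrAC ler_pM2r.
(* [lam = x / C] makes the bound of [size_bias_tail] at least as strong as the
   claim, because [(N + tau) * (4 * N + tau) >= (2 * N + tau) ^+ 2]. *)
pose x := tau / (2 * N + tau).
have den0 : 0 < 2 * N + tau by lra.
have x0 : 0 <= x by rewrite divr_ge0 // ltW.
(* The exponent is proportional to [N * x ^+ 2 - tau * x], minimal at [tau / (2 * N)], which may
   exceed 1; the extra [tau] in the denominator keeps [lam * C <= 1]. *)
have x1 : x <= 1 by rewrite ler_pdivrMr //; lra.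
pose lam := x / C.
have lam0 : 0 <= lam by rewrite divr_ge0 // ltW.
have lamC : lam * (norm2 a * K) <= 1.
  apply: (@le_trans _ _ (lam * C)); first by rewrite ler_wpM2l.
  by rewrite /lam divfK // gt_eqF.
pose F := distribution P W.
have F_ge0 i : \forall y \ae F, 0 <= tnth y i.
  apply: ae_distribution_tnth_ge0.
  by apply: filterS W_ge0 => w /(_ i); rewrite tnth_mktuple.
have F_mean i : 'E_F[fun y => tnth y i]%E = (tnth mu i)%:E.
  rewrite -W_mean; apply: expectation_distribution_tnth.
  by apply: filterS W_ge0 => w /(_ i); rewrite tnth_mktuple.
have M0 : 0 <= nu + tau ^+ 2 by rewrite addr_ge0 // sqr_ge0.
have := size_bias_tail F_ge0 a0 mu_gt0 (ltW K0) M0 F_mean W_coupling lam0 lamC.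
rewrite -/nu => tail.
apply: (@le_trans _ _ (F [set y | nu + tau ^+ 2 <=
    \sum_(i < n.+1) tnth a i * Num.max (tnth y i) 0])).
  rewrite /F /distribution /pushforward; apply: le_measure; rewrite ?inE //.
    rewrite -[X in measurable X]setTI; apply: measurable_funPT => //.
    apply: measurable_superlevel; apply: measurable_sum => i.
    by apply: measurable_funM => //; exact: measurable_tnth_pos.
  (* The coordinate inequalities are summed with weights [a]; as
     [tnth a i * tnth sigma i = tnth t i], the deviations add up to [tau ^+ 2]. *)
  move=> w /= Ww; rewrite tau2 /nu -big_split /=; apply: ler_sum => i _.
  have Wi : tnth t i * tnth sigma i <= tnth (W w) i - tnth mu i.
    by have := Ww i; rewrite !tnth_mktuple ler_pdivlMr.
  have -> : tnth a i * tnth mu i + tnth t i ^+ 2 =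
      tnth a i * (tnth mu i + tnth t i * tnth sigma i).
    by rewrite aE; field; rewrite gt_eqF.
  rewrite ler_wpM2l //; first by rewrite aE divr_ge0 // ltW.
  by rewrite le_max; apply/orP; left; lra.
apply: le_trans tail _; rewrite lee_fin ler_expR.
(* The terms [nu * lam] cancel because the level is [nu + tau ^+ 2]. *)
apply: (@le_trans _ _ (tau * N * C * lam ^+ 2 - lam * tau ^+ 2)).
  have : nu * (norm2 a * K) * lam ^+ 2 <= tau * N * C * lam ^+ 2.
    rewrite ler_wpM2r ?sqr_ge0 // ler_pM //.
    by rewrite mulr_ge0 ?sqrtr_ge0 // ltW.
  lra.
have -> : tau * N * C * lam ^+ 2 - lam * tau ^+ 2 =
   - (tau ^+ 2 * s / K * ((N + tau) / (2 * N + tau) ^+ 2)).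
  rewrite /lam /x /C; field.
  by rewrite !gt_eqF.
have -> : tau ^+ 2 / (2 * (2 * K / s * N + K / (2 * s) * tau)) =
   tau ^+ 2 * s / K * (4 * N + tau)^-1.
  have KN : 0 <= K * N by rewrite mulr_ge0 // ltW.
  have Kt : 0 < K * tau by rewrite mulr_gt0.
  by field; apply/and4P; split; rewrite gt_eqF //; lra.
rewrite lerN2 ler_wpM2l //.
  by rewrite divr_ge0 ?mulr_ge0 ?sqr_ge0 // ltW.
have d2 : 0 < (2 * N + tau) ^+ 2 by rewrite exprn_gt0.
rewrite ler_pdivlMr // mulrC ler_pdivrMr; last by lra.
(* The two sides differ by [N * tau]. *)
nra.
Qed.
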